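(* Consider a network with $n$ nodes, excitation matrix $B$, measurement matrix $C$, edge set $E=E^0\sqcup E^\Delta$ and known part $G^0$. The network is generically decoupled-identifiable (i.e. decoupled-identifiable at almost all pairs $(G,G')$ of consistent network matrices) if and only if, for almost all pairs $(G,G')$ of consistent network matrices, its decoupled network $\hat G(G,G')$ is generically identifiable.
   Context: Network. There are $n$ nodes, a set $\mathcal B$ of $n_B$ excited nodes and a set $\mathcal C$ of $n_C$ measured nodes. $B\in\{0,1\}^{n\times n_B}$ is the selection matrix of $\mathcal B$ (full column rank, each column has exactly one 1, marking an excited node); $C\in\{0,1\}^{n_C\times n}$ is the selection matrix of $\mathcal C$ (full row rank, each row has exactly one 1, marking a measured node). The network topology is a directed graph on the nodes with edge set $E$; the edge from $j$ to $i$ corresponds to the matrix entry $(i,j)$. $E$ is the disjoint union of the known edges $E^0$ and the unknown edges $E^\Delta$. A single frequency is considered, so transfer functions are complex numbers. A network matrix is $G\in\mathbb C^{n\times n}$ with zero entries outside $E$ and with prescribed known entries $G^0$ on $E^0$ (''consistent'' network matrix); consistent matrices are parametrized by their unknown entries (on $E^\Delta$) in $\mathbb C^{|E^\Delta|}$. Well-posedness is assumed throughout: only $G$ with $I-G$ invertible are considered (and such $G$ exist); $T(G)=(I-G)^{-1}$. Decoupled identifiability. For consistent $G,G'$, the network is decoupled-identifiable at $(G,G')$ if for all $\Delta\in\mathbb C^{n\times n}$ supported on $E^\Delta$: $C\,T(G)\,\Delta\,T(G')\,B=0\Rightarrow\Delta=0$. Decoupled network. Given consistent $G,G'$ (all of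 whose entries, including those on $E^\Delta$, are regarded as fixed and known), the decoupled network $\hat G(G,G')$ has $2n$ nodes $\{1,\dots,n,1',\dots,n'\}$, network matrix $$\hat G=\begin{bmatrix}G & D\\ 0 & G'\end{bmatrix},$$ where the block $D\in\mathbb C^{n\times n}$ is supported on $E^\Delta$ and contains the unknown transfer functions, and excitation and measurement matrices $$\hat B=\begin{bmatrix}0&0\\0&B\end{bmatrix},\qquad \hat C=\begin{bmatrix}C&0\\0&0\end{bmatrix}.$$ Identifiability of the decoupled network. For fixed $(G,G')$, the decoupled network is identifiable at $D$ if for all $\tilde D\in\mathbb C^{n\times n}$ supported on $E^\Delta$, with $\hat{\tilde G}=\begin{bmatrix}G&\tilde D\\0&G'\end{bmatrix}$: $\hat C(I-\hat{\tilde G})^{-1}\hat B=\hat C(I-\hat G)^{-1}\hat B\Rightarrow\tilde D=D$. It is generically identifiable if it is identifiable at almost all $D$ supported on $E^\Delta$. Genericity. ''Almost all'' means all except possibly those lying on a lower-dimensional set, i.e. a set of dimension lower than that of the parameter space ($\mathbb C^{|E^\Delta|}$ for $D$, $\mathbb C^{2|E^\Delta|}$ for $(G,G')$), for instance a set contained in the zero set of a nonzero polynomial. *)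

(* Defs.v *)
From HB Require Import structures.
From mathcomp Require Import all_boot all_order all_algebra.
From mathcomp Require Export reals.
From mathcomp Require Export complex.
From mathcomp Require Export mpoly.

Set Implicit Arguments.
Unset Strict Implicit.
Unset Printing Implicit Defensive.

Import GRing.Theory.
Local Open Scope ring_scope.

Section Genericity.
Variable K : fieldType.

(* A subset of K^N is lower-dimensional when its Zariski closure is, i.e. when
   it lies in the zero set of a nonzero polynomial. *)
Definition lower_dimensional (N : nat) (S : {ffun 'I_N -> K} -> Prop) : Prop :=
  exists2 p : {mpoly K[N]}, p != 0 & forall v, S v -> p.@[v] = 0.

(* [P x] for almost all [x] in the family [F], where [F] is parametrized by the
   coordinates [c x] in K^N. *)
Definition almost_all (T : Type) (N : nat) (c : T -> {ffun 'I_N -> K})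
    (F P : T -> Prop) : Prop :=
  lower_dimensional (fun v => exists x, [/\ F x, ~ P x & v = c x]).

End Genericity.

Section Network.
Variables (K : fieldType) (n : nat).

(* Edge sets are sets of matrix positions: [(i, j)] is the edge from j to i. *)
Implicit Types (E ED : {set 'I_n * 'I_n}) (G D : 'M[K]_n).

(* The columns of [M] select the nodes of [S]; row selections are handled by
   transposition. *)
Definition selection_matrix (S : {set 'I_n}) (m : nat) (M : 'M[K]_(n, m)) :
    Prop :=
  [/\ #|S| = m,
      forall i j, M i j = 0 \/ M i j = 1,
      forall j, exists2 i, i \in S & forall k, M k j = 1 <-> k = i
    & \rank M = m].

Definition supported ED D : Prop :=
  forall i j, (i, j) \notin ED -> D i j = 0.

(* Only the entries of [G0] at positions in [E0] matter. *)
Definition consistent E (E0 : {set 'I_n * 'I_n}) (G0 G : 'M[K]_n) : Prop :=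
  supported E G /\ (forall i j, (i, j) \in E0 -> G i j = G0 i j).

Definition well_posed G : Prop := 1%:M - G \in unitmx.

Definition transfer (m : nat) (G : 'M[K]_m) : 'M[K]_m := invmx (1%:M - G).

Definition entries ED G : {ffun 'I_#|ED| -> K} :=
  [ffun k => G (enum_val k).1 (enum_val k).2].

Definition pair_entries ED (GG : 'M[K]_n * 'M[K]_n) :
    {ffun 'I_(#|ED| + #|ED|) -> K} :=
  [ffun k => match split k with
             | inl a => entries ED GG.1 a
             | inr b => entries ED GG.2 b
             end].

Definition almost_all_pairs E (E0 : {set 'I_n * 'I_n}) ED (G0 : 'M[K]_n)
    (P : 'M[K]_n -> 'M[K]_n -> Prop) : Prop :=
  almost_all (pair_entries ED)
    (fun GG => [/\ consistent E E0 G0 GG.1, well_posed GG.1,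
                   consistent E E0 G0 GG.2 & well_posed GG.2])
    (fun GG => P GG.1 GG.2).

Variables (nB nC : nat) (B : 'M[K]_(n, nB)) (C : 'M[K]_(nC, n)).

Definition decoupled_identifiable_at ED (G G' : 'M[K]_n) : Prop :=
  forall Delta, supported ED Delta ->
    C *m transfer G *m Delta *m transfer G' *m B = 0 -> Delta = 0.

Definition generically_decoupled_identifiable E (E0 : {set 'I_n * 'I_n}) ED
    (G0 : 'M[K]_n) : Prop :=
  almost_all_pairs E E0 ED G0 (decoupled_identifiable_at ED).

Definition hatG (G G' D : 'M[K]_n) : 'M[K]_(n + n) := block_mx G D 0 G'.

Definition hatB : 'M[K]_(n + n, nB + nB) := block_mx 0 0 0 B.

Definition hatC : 'M[K]_(nC + nC, n + n) := block_mx C 0 0 0.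

Definition decoupled_network_identifiable_at ED (G G' D : 'M[K]_n) : Prop :=
  forall D', supported ED D' ->
    hatC *m transfer (hatG G G' D') *m hatB =
    hatC *m transfer (hatG G G' D) *m hatB -> D' = D.

Definition decoupled_network_generically_identifiable ED (G G' : 'M[K]_n) :
    Prop :=
  almost_all (entries ED) (supported ED)
    (decoupled_network_identifiable_at ED G G').

End Network.

(* Main.v *)
Require Import Defs.
From mathcomp Require Import all_boot all_order all_algebra.
From mathcomp Require Import reals complex.

Set Implicit Arguments.
Unset Strict Implicit.
Unset Printing Implicit Defensive.

Import GRing.Theory Num.Theory.
Local Open Scope ring_scope.
Local Open Scope complex_scope.

(** The equivalence holds pair by pair, before any genericity in (G, G').
    Since hatG is block upper triangular, the upper right block of its transfer
    matrix is T(G) D T(G'), so the measured response of the decoupled network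
    is affine in D and two unknowns D, D' are indistinguishable exactly when
    their difference Delta = D' - D satisfies C T(G) Delta T(G') B = 0.
    Identifiability at D is therefore the same condition for every D, namely
    decoupled identifiability at (G, G')
    ([decoupled_network_identifiable_atP]).

    A property that does not depend on D holds for almost all D if and only if
    it holds: otherwise the exceptional set is the whole parameter space, which
    is not lower-dimensional because a nonzero polynomial over an infinite
    domain does not vanish identically ([mpoly_eq0_meval]).  Thus for well-posed
    pairs the two properties quantified by almost all (G, G') coincide
    ([decoupled_network_generically_identifiableP]). *)

Lemma poly_eq0_horner (K : idomainType) (a : nat -> K) (p : {poly K}) :
  injective a -> (forall x, p.[x] = 0) -> p = 0.
Proof.
move=> a_inj p0; apply: (@roots_geq_poly_eq0 _ _ (map a (iota 0 (size p)))).
- by apply/allP => x _; apply/eqP/p0.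
- by rewrite map_inj_uniq ?iota_uniq.
- by rewrite size_map size_iota.
Qed.

(** Splitting off the last exponent is injective on monomials, so no
    cancellation occurs when the terms of p are regrouped by powers of the last
    variable. *)
Lemma muni_coef (K : nzRingType) (n : nat) (p : {mpoly K[n.+1]})
    (m : 'X_{1.. n.+1}) :
  ((muni p)`_(m ord_max))@_[multinom m (widen_ord (leqnSn n) i) | i < n]
    = p@_m.
Proof.
rewrite muniE coef_sum raddf_sum /=.
rewrite (eq_bigr (fun m' => p@_m' *+ (m' == m))); last first.
  move=> m' _; rewrite !coefZ coefXn.
  have -> : (m' == m) =
      ([multinom m' (widen_ord (leqnSn n) i) | i < n] ==
       [multinom m (widen_ord (leqnSn n) i) | i < n])
      && (m ord_max == m' ord_max :> nat).
    apply/eqP/andP => [-> // | [/eqP/mnmP eq_w /eqP eq_l]].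
    apply/mnmP => i; case: (unliftP ord_max i) => [j|] -> //.
    have -> : lift ord_max j = widen_ord (leqnSn n) j.
      by apply: val_inj; rewrite /= /bump leqNgt ltn_ord.
    by have := eq_w j; rewrite !mnmE.
  case: (m ord_max == _); rewrite ?andbT ?andbF ?mulr1 ?mulr0 ?mcoeff0 //.
  by rewrite mcoeffZ mcoeffX mulr_natr.
case: (boolP (m \in msupp p)) => [m_in|m_out].
  rewrite (bigD1_seq m) ?msupp_uniq //= eqxx big1 ?addr0 //.
  by move=> m' /negbTE ->.
rewrite (memN_msupp_eq0 m_out) big1_seq // => m' /andP [_ m'_in].
by case: eqP m'_in m_out => // -> ->.
Qed.

Lemma muni_horner (K : comNzRingType) (n : nat) (p : {mpoly K[n.+1]})
    (v : 'I_n -> K) (x : K) :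
  (map_poly (meval v) (muni p)).[x]
    = p.@[fun i => if unlift ord_max i is Some j then v j else x].
Proof.
rewrite muniE rmorph_sum /= horner_sum mevalE; apply: eq_bigr => m _.
rewrite -mul_polyC rmorphM /= map_polyC /= map_polyXn hornerM hornerC hornerXn.
rewrite mevalZ mevalX -mulrA; congr (_ * _).
rewrite big_ord_recr /= unlift_none; congr (_ * _); apply: eq_bigr => i _.
have -> : widen_ord (leqnSn n) i = lift ord_max i.
  by apply: val_inj; rewrite /= /bump leqNgt ltn_ord.
rewrite liftK mnmE; congr (_ ^+ m _).
by apply: val_inj; rewrite /= /bump leqNgt ltn_ord.
Qed.

(** By induction on the number of variables: freezing all variables but the
    last leaves a univariate polynomial with infinitely many roots, so each of
    its coefficients, a polynomial in the frozen variables, vanishes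
    everywhere. *)
Lemma mpoly_eq0_meval (K : idomainType) (a : nat -> K) (n : nat)
    (p : {mpoly K[n]}) :
  injective a -> (forall v, p.@[v] = 0) -> p = 0.
Proof.
move=> a_inj; elim: n p => [|n IHn] p p0.
  have := p0 (fun=> 0); rewrite mevalE => sum0.
  apply/mpolyP => m; rewrite mcoeff0.
  have m0 (m' : 'X_{1.. 0}) : m' = m by apply/mnmP; case.
  case: (boolP (m \in msupp p)) => [m_in|/memN_msupp_eq0 //].
  rewrite -[RHS]sum0 (bigD1_seq m) ?msupp_uniq //= big_ord0 mulr1.
  by rewrite big1 ?addr0 // => m'; rewrite (m0 m') eqxx.
have muni0 k : (muni p)`_k = 0.
  apply: IHn => v; rewrite -coef_map.
  rewrite (_ : map_poly _ _ = 0) ?coef0 //.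
  by apply: (poly_eq0_horner a_inj) => x; rewrite muni_horner p0.
by apply/mpolyP => m; rewrite -muni_coef muni0 !mcoeff0.
Qed.

Lemma lower_dimensional_proper (K : fieldType) (a : nat -> K) (N : nat)
    (S : {ffun 'I_N -> K} -> Prop) :
  injective a -> lower_dimensional S -> ~ (forall v, S v).
Proof.
move=> a_inj [p /eqP p_neq0 pS] fullS; apply/p_neq0/(mpoly_eq0_meval a_inj) => v.
by rewrite -(pS _ (fullS (finfun v))); apply: meval_eq => i; rewrite ffunE.
Qed.

Lemma eq_almost_all (K : fieldType) (T : Type) (N : nat)
    (c : T -> {ffun 'I_N -> K}) (F P Q : T -> Prop) :
  (forall x, F x -> (P x <-> Q x)) ->
  almost_all c F P <-> almost_all c F Q.
Proof.
move=> PQ; split=> -[p p_neq0 pS]; exists p => // v [x [Fx nP ->]];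
  by apply: pS; exists x; split=> // /(PQ x Fx).
Qed.

Section Decoupled.
Variables (K : fieldType) (n nB nC : nat).
Variables (B : 'M[K]_(n, nB)) (C : 'M[K]_(nC, n)) (ED : {set 'I_n * 'I_n}).
Implicit Types G D : 'M[K]_n.

Lemma entries_onto (v : {ffun 'I_#|ED| -> K}) :
  exists2 D, supported ED D & v = entries ED D.
Proof.
exists (\matrix_(i, j) \sum_(k | enum_val k == (i, j)) v k).
  move=> i j notED; rewrite mxE big_pred0 // => k.
  by apply: contraNF notED => /eqP <-; exact: enum_valP.
apply/ffunP => k; rewrite ffunE mxE -surjective_pairing.
by rewrite (big_pred1 k) // => l; rewrite /= (inj_eq enum_val_inj).
Qed.

Lemma transfer_hatG G G' D : well_posed G -> well_posed G' ->
  transfer (hatG G G' D)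
    = block_mx (transfer G) (transfer G *m D *m transfer G') 0 (transfer G').
Proof.
rewrite /well_posed => uG uG'; rewrite /transfer /hatG.
rewrite (scalar_mx_block n n) opp_block_mx add_block_mx !oppr0 !add0r.
set M := block_mx _ (- D) _ _; set N := (RHS).
have MN : M *m N = 1%:M.
  rewrite mulmx_block !mulmx0 !mul0mx !addr0 add0r !mulmxV //.
  by rewrite !mulmxA mulmxV // mul1mx mulNmx subrr -scalar_mx_block.
have [uM _] := mulmx1_unit MN.
by rewrite -[N]mul1mx -(mulVmx uM) -mulmxA MN mulmx1.
Qed.

Lemma response_hatG G G' D : well_posed G -> well_posed G' ->
  hatC C *m transfer (hatG G G' D) *m hatB B
    = block_mx 0 (C *m transfer G *m D *m transfer G' *m B) 0 0.
Proof.
move=> wG wG'; rewrite transfer_hatG // /hatC /hatB !mulmx_block.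
by rewrite !(mul0mx, mulmx0, addr0, add0r) !mulmxA.
Qed.

(** The response is affine in D, so what is identified is a difference of two
    matrices supported on [ED], whatever the reference point D. *)
Lemma decoupled_network_identifiable_atP G G' D :
  well_posed G -> well_posed G' -> supported ED D ->
  decoupled_network_identifiable_at B C ED G G' D
    <-> decoupled_identifiable_at B C ED G G'.
Proof.
move=> wG wG' sD; split=> ident.
  move=> Delta sDelta CTB0; apply: (addIr D); rewrite add0r.
  apply: ident => [i j notED|]; first by rewrite mxE sDelta ?sD ?addr0.
  by rewrite !response_hatG // mulmxDr !mulmxDl CTB0 add0r.
move=> D' sD'; rewrite !response_hatG // => /eq_block_mx [_ eqD _ _].
apply/eqP; rewrite -subr_eq0; apply/eqP/ident => [i j notED|].
  by rewrite !mxE sD' ?sD ?subr0.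
by rewrite mulmxBr !mulmxBl eqD subrr.
Qed.

Lemma decoupled_network_generically_identifiableP (a : nat -> K) G G' :
  injective a -> well_posed G -> well_posed G' ->
  decoupled_network_generically_identifiable B C ED G G'
    <-> decoupled_identifiable_at B C ED G G'.
Proof.
move=> a_inj wG wG'; split=> [gen | ident]; last first.
  (* The exceptional set is empty, hence in the zero set of the polynomial 1. *)
  exists 1; first exact: oner_neq0.
  by move=> v [D [sD []]]; apply/decoupled_network_identifiable_atP.
move=> Delta sDelta CTB0; apply/eqP/negPn/negP => /eqP Delta_neq0.
apply: (lower_dimensional_proper a_inj gen) => v.
have [D sD ->] := entries_onto v; exists D; split=> //.
by move/(decoupled_network_identifiable_atP wG wG' sD)/(_ Delta sDelta CTB0).
Qed.

End Decoupled.

Theorem mainTheorem3 (R : realType) (n nB nC : nat)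
    (excited measured : {set 'I_n})
    (B : 'M[R[i]]_(n, nB)) (C : 'M[R[i]]_(nC, n))
    (hB : selection_matrix excited B)
    (hC : selection_matrix measured C^T)
    (E E0 ED : {set 'I_n * 'I_n})
    (hE : E = E0 :|: ED) (hdisj : [disjoint E0 & ED])
    (G0 : 'M[R[i]]_n)
    (hwp : exists2 G : 'M[R[i]]_n, consistent E E0 G0 G & well_posed G) :
  generically_decoupled_identifiable B C E E0 ED G0 <->
  almost_all_pairs E E0 ED G0
    (fun G G' => decoupled_network_generically_identifiable B C ED G G').
Proof.
have nat_inj : injective (fun k : nat => k%:R : R[i]).
  by move=> k l /eqP; rewrite eqr_nat => /eqP.
apply: eq_almost_all => -[G G'] [_ wG _ wG'] /=.
by apply: iff_sym; apply: (decoupled_network_generically_identifiableP _ _ _ nat_inj).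
Qed.
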